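(* Let $p$ be a prime, $n\ge1$, $q=p^n$. Let $L$ be a monic $p$-linearized polynomial that divides $x^q-x$, set $p^{n-k}=\deg(L)$ and $U_L=\{z\in\overline{\mathbb{F}}_q: L(z)=0\}$. Let $\{\zeta_i\}_{0\le i\le p^k-1}$ be any complete set of representatives for the quotient $\mathbb{F}_q/U_L$. Suppose that $P(x)=f(L(x))+M(x)\in\mathbb{F}_q[x]$ is a permutation polynomial over $\mathbb{F}_q$, where $f,M\in\mathbb{F}_q[x]$ and $M$ is a $p$-linearized polynomial. Then $P_0(x)=f_0(L_0(x))+M_0(x)\in\mathbb{F}_q[x]$ is the inverse permutation polynomial of $P$ over $\mathbb{F}_q$ (that is, $P_0(P(y))=y$ for every $y\in\mathbb{F}_q$), where $f_0,L_0$ and $M_0$ are given as follows: (i) $L_0(x)=\prod_{u\in M(U_L)}(x-u)$; (ii) $M_0\in\mathbb{F}_q[x]$ is the unique $p$-linearized polynomial of degree at most $p^{n-k}-1$ such that $M_0(M(u))=u$ for every $u\in U_L$; (iii) $f_0\in\mathbb{F}_q[x]$ is the unique polynomial of degree at most $p^k-1$ such that $f_0(L_0(P(\zeta_i)))+M_0(P(\zeta_i))=\zeta_i$ for every $0\le i\le p^k-1$. In particular, the additive indices of $P$ and $P_0$ coincide.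
   Context: A $p$-linearized polynomial is a polynomial of the form $\sum_{i=0}^m a_i x^{p^i}$ with coefficients in $\overline{\mathbb{F}}_p$ (the zero polynomial is allowed). A polynomial in $\mathbb{F}_q[x]$ is a permutation polynomial over $\mathbb{F}_q$ if it induces a bijection of $\mathbb{F}_q$. Additive index: for $R\in\mathbb{F}_q[x]$, let $V$ be the set of $y\in\mathbb{F}_q$ such that, with $\tilde R(x)=R(x)-R(0)$, the identity $\tilde R(x+y)-\tilde R(x)-\tilde R(y)=0$ holds in $\mathbb{F}_q[x]$. Then $\mathcal{L}(x)=\prod_{v\in V}(x-v)$ is a monic $p$-linearized polynomial dividing $x^q-x$; if $\deg(\mathcal{L})=p^{n-s}$, then $R$ is said to have additive index $s$ over $\mathbb{F}_q$.
   Formalization: The additive index of P is taken for P reduced modulo x^q − x (P itself if deg P < q), since the last claim fails otherwise: with L = x, M = 0, P = x + x^{q+1} − x^2 has index n but P_0 = x has index 0. *)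

(* Defs.v *)
(* MathComp *)
From HB Require Import structures.
From mathcomp Require Import all_boot all_order all_algebra all_field.

Set Implicit Arguments.
Unset Strict Implicit.
Unset Printing Implicit Defensive.

Import GRing.Theory.
Local Open Scope ring_scope.

Definition p_linearized (p : nat) (R : nzRingType) (A : {poly R}) : Prop :=
  exists (m : nat) (a : nat -> R), A = \sum_(i < m.+1) a i *: 'X^(p ^ i).

Definition permutation_poly (F : finFieldType) (P : {poly F}) : Prop :=
  bijective (horner P).

(* For A != 0, the set {z | A(z) = 0} as a duplicate-free sequence;
   see mem_zeros and zeros_uniq. *)
Definition zeros (K : closedFieldType) (A : {poly K}) : seq K :=
  undup (sval (closed_field_poly_normal A)).

Lemma zeros_uniq (K : closedFieldType) (A : {poly K}) : uniq (zeros A).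
Proof. exact: undup_uniq. Qed.

Lemma mem_zeros (K : closedFieldType) (A : {poly K}) (z : K) :
  A != 0 -> (z \in zeros A) = root A z.
Proof.
move=> A0; rewrite mem_undup; case: closed_field_poly_normal => r /= Ar.
by rewrite [in RHS]Ar rootZ ?lead_coef_eq0 // root_prod_XsubC.
Qed.

(* The distinct elements of the image A(U). *)
Definition poly_image (K : fieldType) (A : {poly K}) (U : seq K) : seq K :=
  undup [seq A.[u] | u <- U].

Definition vanishing_poly (K : fieldType) (U : seq K) : {poly K} :=
  \prod_(u <- U) ('X - u%:P).

(* F stands for F_q, viewed inside K through iota. *)
Definition complete_representatives (F : finFieldType) (K : closedFieldType)
    (iota : {rmorphism F -> K}) (U : seq K) (N : nat) (zeta : 'I_N -> F) :
    Prop :=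
  forall y : F, exists! i : 'I_N, iota y - iota (zeta i) \in U.

(* The defining identity is one of polynomials, not merely of functions
   on F. *)
Definition additive_translations (F : finFieldType) (R : {poly F}) : {set F} :=
  let Rt := R - (R.[0])%:P in
  [set y : F | Rt \Po ('X + y%:P) - Rt - (Rt.[y])%:P == 0].

(* Over a field with p ^ n elements; the bound s <= n keeps the truncated
   subtraction faithful, so that s is determined by R. *)
Definition has_additive_index (p n : nat) (F : finFieldType) (R : {poly F})
    (s : nat) : Prop :=
  (s <= n)%N /\
  size (\prod_(v in additive_translations R) ('X - v%:P)) = (p ^ (n - s)).+1.

(* The representative of degree less than q of the function on F_q induced
   by R; the additive index is invariant under inversion only for such
   representatives: x and x + x^(q+1) - x^2 both induce the identity, but have
   additive indices 0 and n. *)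
Definition reduced (q : nat) (F : finFieldType) (R : {poly F}) : {poly F} :=
  R %% ('X^q - 'X).

(* Main.v *)
Require Import Defs.
From HB Require Import structures.
From mathcomp Require Import all_boot all_order all_algebra all_field.
From mathcomp Require Import all_fingroup.
From mathcomp Require Import ring.

Set Implicit Arguments.
Unset Strict Implicit.
Unset Printing Implicit Defensive.

Import GRing.Theory.
Local Open Scope ring_scope.

(** The zeros of [L] are the image of a subgroup [V] of F_q of order p^(n-k).
    Both [L] and [M] are additive maps, so [P] carries a coset [x + V] to the coset
    [P(x) + M(V)] by [P(x + v) = P(x) + M(v)]; injectivity of [P] makes [M]
    injective on [V].  Inverting [P] therefore splits in two.  Inside a coset
    one must invert [M] on [V]: this is the task of [M0].  Between cosets one
    must go back from [P(x) + M(V)] to [x + V]: the polynomial [L0], additive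
    with kernel [M(V)], separates the cosets of [M(V)], so a Lagrange
    interpolant [f0] at the p^k points [L0(P(zeta_i))] can restore the
    representative.  If [y = zeta_i + v], then [L0(P(y)) = L0(P(zeta_i))] and
    [M0(P(y)) = M0(P(zeta_i)) + v], whence [P0(P(y)) = zeta_i + v = y].

    Uniqueness of [f0] and [M0] is uniqueness of Lagrange interpolation.  What
    remains for [M0] is that the interpolant of a partial inverse of an additive
    map is p-linearized.  A degree count does this: if A has degree at most N
    and is additive on a set V of N points, then A(X + v) - A(X) - A(v) has
    degree less than N and vanishes on V, so it is zero for every v in V; hence
    A(X + c) - A(X) - A(c) vanishes on V for every c, and is zero as well
    ([additive_poly_of_seq]).  The same lemma gives the additivity of [L0].
    Finally, an additive polynomial over an algebraically closed field has a
    constant derivative, so it is [a X + B(X^p)] with [B] again additive, and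
    induction on the degree shows that it is p-linearized
    ([additive_p_linearized]).

    The additive indices agree for a reason that has nothing to do with the
    shape of [P]: for a polynomial R of degree less than q, the translation set
    consists of the y with R(x + y) + R(0) = R(x) + R(y) for all x in F_q, and
    y |-> P(y) - P(0) embeds the translation set of a permutation [P] into that
    of its inverse ([card_additive_translations_le]). *)

(** * Interpolation *)

Lemma poly_eq_on_seq (R : idomainType) (A B : {poly R}) (s : seq R) :
    uniq s -> (size A <= size s)%N -> (size B <= size s)%N ->
  {in s, forall x, A.[x] = B.[x]} -> A = B.
Proof.
move=> s_uniq sA sB eqAB; apply/eqP; rewrite -subr_eq0; apply/eqP.
apply: (roots_geq_poly_eq0 (rs := s)) => //; last first.
  by rewrite (leq_trans (size_polyD _ _)) // geq_max size_polyN sA.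
by apply/allP => x xs; rewrite rootE !hornerE eqAB ?subrr.
Qed.

Lemma lagrange_interpolation (E : fieldType) (I : eqType) (s : seq I)
    (x y : I -> E) :
  uniq [seq x i | i <- s] ->
  exists A : {poly E},
    unique (fun B : {poly E} =>
      (size B <= size s)%N /\ {in s, forall i, B.[x i] = y i}) A.
Proof.
move=> xs_uniq; suff [A [sA Axy]]: exists A : {poly E},
    (size A <= size s)%N /\ {in s, forall i, A.[x i] = y i}.
  exists A; split=> // B [sB Bxy].
  apply: (poly_eq_on_seq xs_uniq); rewrite ?size_map //.
  by move=> _ /mapP[i si ->]; rewrite Axy ?Bxy.
elim: s xs_uniq => [|i s IHs] /=; first by exists 0; rewrite size_poly0.
case/andP=> xi_s /IHs[A [sA Axy]].
pose Z := \prod_(j <- s) ('X - (x j)%:P); pose c := (y i - A.[x i]) / Z.[x i].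
have Zxi : Z.[x i] != 0.
  rewrite -[Z](big_map x xpredT (fun a => 'X - a%:P)).
  by rewrite -rootE root_prod_XsubC.
exists (A + c *: Z); split.
  rewrite (leq_trans (size_polyD _ _)) // geq_max ltnW //=.
  by rewrite (leq_trans (size_scale_leq _ _)) // size_prod_XsubC.
move=> j; rewrite inE hornerD hornerZ => /predU1P[-> | sj].
  by rewrite divfK // addrC subrK.
suff -> : Z.[x j] = 0 by rewrite mulr0 addr0 Axy.
apply/eqP; rewrite -rootE -[Z](big_map x xpredT (fun a => 'X - a%:P)).
by rewrite root_prod_XsubC map_f.
Qed.

(** * Additive polynomials *)

(** Additivity of the induced function.  Over an infinite field this is
    additivity as a formal polynomial; over a finite field it is weaker. *)
Definition additive_poly (R : nzRingType) (A : {poly R}) : Prop :=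
  forall x y : R, A.[x + y] = A.[x] + A.[y].

Lemma additive_poly0 (R : nzRingType) (A : {poly R}) :
  additive_poly A -> A.[0] = 0.
Proof. by move=> addA; apply/(addrI A.[0]); rewrite -addA !addr0. Qed.

Lemma additive_polyB (R : nzRingType) (A : {poly R}) (x y : R) :
  additive_poly A -> A.[x - y] = A.[x] - A.[y].
Proof. by move=> addA; apply/(addIr A.[y]); rewrite -addA !subrK. Qed.

(** The leading terms of [A(X + c)] and [A(X)] cancel. *)
Lemma size_comp_XaddC_sub (R : idomainType) (A : {poly R}) (c : R) :
  (size (A \Po ('X + c%:P) - A)%R <= (size A).-1)%N.
Proof.
have [-> | A0] := eqVneq A 0; first by rewrite comp_poly0 subr0 size_poly0.
have sAc : size (A \Po ('X + c%:P)) = size A.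
  by rewrite size_comp_poly2 // size_XaddC.
apply/leq_sizeP => j; rewrite leq_eqVlt => /predU1P[<- | ltj].
  rewrite coefB -{1}sAc; have := lead_coef_comp A (q := 'X + c%:P).
  rewrite size_XaddC lead_coefXaddC expr1n mulr1 /lead_coef => -> //.
  by rewrite subrr.
rewrite -ltnS prednK ?lt0n ?size_poly_eq0 // in ltj.
by rewrite coefB !nth_default ?subrr ?sAc.
Qed.

(** A test of additivity on few points.  For fixed [c], the defect
    [D c = A(X + c) - A(X) - A(c)] has degree less than the number of points,
    so it is zero once it vanishes on [V].  Used for [c] in [V] this extends
    additivity to one argument outside [V], which is what is needed to use it
    again for arbitrary [c]. *)
Lemma additive_poly_of_seq (R : idomainType) (A : {poly R}) (V : seq R) :
    uniq V -> (0 < size V)%N -> (size A <= (size V).+1)%N ->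
    {in V &, forall v w, A.[v + w] = A.[v] + A.[w]} ->
  additive_poly A.
Proof.
move=> V_uniq V_gt0 sA addV.
pose D c := A \Po ('X + c%:P) - A - (A.[c])%:P.
have DE c x : (D c).[x] = A.[x + c] - A.[x] - A.[c].
  by rewrite !hornerE horner_comp !hornerE.
have addD c : {in V, forall v, A.[v + c] = A.[v] + A.[c]} ->
    forall x, A.[x + c] = A.[x] + A.[c].
  move=> addVc x; apply/eqP; rewrite -subr_eq0 opprD addrA -DE.
  suff -> : D c = 0 by rewrite horner0.
  apply: (poly_eq_on_seq V_uniq); rewrite ?size_poly0 //.
    rewrite (leq_trans (size_polyD _ _)) // geq_max size_polyN.
    rewrite (leq_trans (size_polyC_leq1 _)) // andbT.
    rewrite (leq_trans (size_comp_XaddC_sub _ _)) //.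
    by rewrite -subn1 leq_subLR add1n.
  by move=> v vV; rewrite DE addVc // addrAC addrK subrr horner0.
move=> x c; apply: (addD c) => v vV.
by rewrite addrC [RHS]addrC; apply: (addD v) => w wV; apply: addV.
Qed.

Lemma p_linearized_additive (p : nat) (R : comNzRingType) (A : {poly R}) :
  p \in [pchar R] -> p_linearized p A -> additive_poly A.
Proof.
move=> charR [m [a ->]] x y; rewrite !horner_sum -big_split /=.
apply: eq_bigr => i _; rewrite !hornerE exprDn_pchar ?mulrDr //.
by rewrite pnatX pnatE ?charR // (pcharf_prime charR).
Qed.

Lemma closed_poly_const (K : closedFieldType) (A : {poly K}) :
  (forall x, A.[x] = A.[0]) -> A = (A.[0])%:P.
Proof.
move=> cstA; apply/eqP; rewrite -subr_eq0; apply/negPn/negP.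
by case/closed_nonrootP=> x; rewrite rootE !hornerE cstA subrr eqxx.
Qed.

(** Differentiating [A(X + x) = A(X) + A(x)] at 0 shows that [A^`()] takes the
    same value at [x] as at 0. *)
Lemma deriv_additive (K : closedFieldType) (A : {poly K}) :
  additive_poly A -> A^`() = (A`_1)%:P.
Proof.
move=> addA; suff cst x : A^`().[x] = A^`().[0].
  by rewrite [LHS]closed_poly_const // horner_coef0 coef_deriv mulr1n.
have Ax : A \Po ('X + x%:P) = A + (A.[x])%:P.
  apply/eqP; rewrite -subr_eq0; apply/negPn/negP => /closed_nonrootP[y].
  by rewrite rootE !hornerE horner_comp !hornerE addA subrr eqxx.
have := congr1 (fun B : {poly K} => B^`().[0]) Ax.
rewrite deriv_comp !derivD derivX !derivC !addr0 mulr1 horner_comp !hornerE.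
by [].
Qed.

(** Since the derivative is constant, only the linear coefficient and those of
    index divisible by [p] survive: [A = a X + B(X^p)].  Every element of [K] is
    a [p]-th power, so [B] inherits additivity from [A] through
    [(x + y)^p = x^p + y^p], and the degree has dropped. *)
Lemma additive_p_linearized (p : nat) (K : closedFieldType) (A : {poly K}) :
  p \in [pchar K] -> additive_poly A -> p_linearized p A.
Proof.
move=> charK; have p_prime := pcharf_prime charK.
have p_gt0 := prime_gt0 p_prime; have p_gt1 := prime_gt1 p_prime.
have [n] := ubnP (size A); elim: n A => // n IHn A ltAn addA.
have [-> | A0] := eqVneq A 0.
  by exists 0, (fun=> 0); rewrite big_ord1 scale0r.
have coefA j : j != 1%N -> ~~ (p %| j)%N -> A`_j = 0.
  case: j => [|[|j]] //; first by rewrite dvdn0.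
  move=> _; rewrite (dvdn_pcharf charK) => j_neq0; apply/eqP.
  have /eqP := congr1 (fun B : {poly K} => B`_j.+1) (deriv_additive addA).
  by rewrite coef_deriv coefC /= -mulr_natr mulf_eq0 (negPf j_neq0) orbF.
pose B := \poly_(i < (size A).-1) A`_(i * p).
have sA_gt1 : (1 < size A)%N.
  rewrite ltnNge; apply: contra A0 => /size1_polyC A1.
  by rewrite A1 -horner_coef0 additive_poly0.
have defA : A = A`_1 *: 'X + (B \Po 'X^p).
  apply/polyP=> j; rewrite coefD coefZ coefX coef_comp_poly_Xn //.
  have [-> | j1] := eqVneq j 1%N; first by rewrite dvdn1 gtn_eqF // mulr1 addr0.
  rewrite mulr0 add0r; case: ifPn => [p_j | /coefA-> //].
  rewrite coef_poly divnK //; case: ltnP => // lej; apply: nth_default.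
  case: j p_j j1 lej => [|j] p_j j1 lej.
    by move: lej; rewrite div0n leqNgt -subn1 subn_gt0 sA_gt1.
  (* the degree of A is at least 1, so twice the degree is beyond it *)
  rewrite -(divnK p_j) (leq_trans _ (leq_mul lej p_gt1)) // muln2 -addnn.
  by case: (size A) sA_gt1 => [|[|m]] //= _; rewrite addnS ltnS leq_addr.
have [m [b defB]] : p_linearized p B.
  apply: IHn => [|x y].
    rewrite -ltnS (leq_trans _ ltAn) // ltnS (leq_ltn_trans (size_poly _ _)) //.
    by rewrite prednK ?(ltnW sA_gt1).
  have rootp z : exists a : K, z = a ^+ p.
    have [|a] := closed_rootP ('X^p - z%:P) _.
      by rewrite size_XnsubC // eqSS -lt0n.
    by rewrite rootE !hornerE subr_eq0 => /eqP <-; exists a.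
  have [[a ->] [c ->]] := (rootp x, rootp y).
  have BE z : B.[z ^+ p] = A.[z] - A`_1 * z.
    have := congr1 (fun C : {poly K} => C.[z]) defA.
    by rewrite !hornerE horner_comp !hornerE => ->; rewrite addrC addKr.
  rewrite -exprDn_pchar; last by rewrite pnatE.
  by rewrite !BE addA mulrDr opprD addrACA.
exists m.+1, (fun i => if i is j.+1 then b j else A`_1).
rewrite big_ord_recl expn0 expr1 {1}defA defB; congr (_ + _).
rewrite linear_sum; apply: eq_bigr => i _ /=.
by rewrite linearZ /= comp_Xn_poly -exprM expnS.
Qed.

Lemma additive_poly_map (E K : fieldType) (iota : {rmorphism E -> K})
    (A : {poly E}) :
  additive_poly (map_poly iota A) -> additive_poly A.
Proof.
move=> addA x y; apply: (fmorph_inj iota).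
by rewrite rmorphD /= -!horner_map rmorphD addA.
Qed.

Lemma root_vanishing_poly (E : fieldType) (V : seq E) (x : E) :
  ((vanishing_poly V).[x] == 0) = (x \in V).
Proof. by rewrite -rootE root_prod_XsubC. Qed.

(** On [V] itself the vanishing polynomial is zero, hence additive; as it has
    only one more coefficient than [V] has points, this is enough. *)
Lemma vanishing_poly_additive (E : fieldType) (V : seq E) :
    uniq V -> 0 \in V -> {in V &, forall v w, v - w \in V} ->
  additive_poly (vanishing_poly V).
Proof.
move=> V_uniq V0 VB.
have VD : {in V &, forall v w, v + w \in V}.
  by move=> v w Vv Vw; rewrite -[w]opprK VB // -sub0r VB.
have in0 x : x \in V -> (vanishing_poly V).[x] = 0.
  by move=> Vx; apply/eqP; rewrite root_vanishing_poly.
apply: (additive_poly_of_seq V_uniq); first by case: (V) V0.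
  by rewrite size_prod_XsubC.
by move=> v w Vv Vw; rewrite !in0 ?addr0 ?VD.
Qed.

Lemma vanishing_poly_image_map (E K : fieldType) (iota : {rmorphism E -> K})
    (M : {poly E}) (V : seq E) (U : seq K) :
    U =i map iota V -> uniq [seq M.[v] | v <- V] ->
  vanishing_poly (poly_image (map_poly iota M) U) =
    map_poly iota (vanishing_poly [seq M.[v] | v <- V]).
Proof.
move=> defU W_uniq; rewrite map_prod_XsubC.
rewrite -(big_map iota xpredT (fun a => 'X - a%:P)).
apply/perm_big/uniq_perm; rewrite ?undup_uniq //.
  by rewrite (map_inj_uniq (fmorph_inj iota)).
move=> z; rewrite mem_undup -map_comp; apply/mapP/mapP => [[u]|[v Vv ->]].
  by rewrite defU => /mapP[v Vv ->] ->; exists v; rewrite //= horner_map.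
by exists (iota v); rewrite ?defU ?map_f //= horner_map.
Qed.

(** * Additive translations and inverse permutations *)

(** Below degree q, the polynomial identity defining the translations can be
    tested on values. *)
Lemma mem_additive_translations (F : finFieldType) (R : {poly F}) (y : F) :
    (size R <= #|F|)%N ->
  reflect (forall x, R.[x + y] + R.[0] = R.[x] + R.[y])
          (y \in additive_translations R).
Proof.
move=> sR; rewrite inE; set D := (X in X == 0).
have DE x : D.[x] = (R.[x + y] + R.[0]) - (R.[x] + R.[y]).
  rewrite /D !hornerE horner_comp !hornerE.
  by ring.
apply: (iffP eqP) => [D0 x | addRy].
  by apply/eqP; rewrite -subr_eq0 -DE D0 horner0.
apply: (poly_eq_on_seq (enum_uniq F)); rewrite ?size_poly0 -?cardE //.
  have q_gt0 : (0 < #|F|)%N by apply/card_gt0P; exists 0.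
  have sub_const (A : {poly F}) c : (size A <= #|F|)%N ->
      (size (A - c%:P)%R <= #|F|)%N.
    move=> sA; rewrite (leq_trans (size_polyD _ _)) // geq_max sA size_polyN.
    by rewrite (leq_trans (size_polyC_leq1 _)).
  rewrite sub_const // (leq_trans (size_comp_XaddC_sub _ _)) //.
  by rewrite (leq_trans (leq_pred _)) ?sub_const.
by move=> x _; rewrite DE addRy subrr horner0.
Qed.

(** If [y] is a translation of [P] and [w = P(y) - P(0)], then
    [P(x + y) = P(x) + w]; applying the inverse [Q] gives [Q(z + w) = Q(z) + y],
    so that [w] is a translation of [Q]. *)
Lemma card_additive_translations_le (F : finFieldType) (P Q : {poly F}) :
    (size P <= #|F|)%N -> (size Q <= #|F|)%N ->
    cancel (horner P) (horner Q) -> cancel (horner Q) (horner P) ->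
  (#|additive_translations P| <= #|additive_translations Q|)%N.
Proof.
move=> sP sQ PK QK; pose w y := P.[y] - P.[0].
have w_inj : injective w by move=> x y /addIr/(can_inj PK).
rewrite -(card_imset _ w_inj).
apply/subset_leq_card/subsetP => _ /imsetP[y Vy ->].
apply/(mem_additive_translations _ sQ) => x.
have Qw z : Q.[z + w y] = Q.[z] + y.
  apply: (canLR PK); rewrite -{1}[z]QK.
  have /(mem_additive_translations _ sP) /(_ Q.[z]) PV := Vy.
  by rewrite /w addrA -PV addrK.
by rewrite Qw -[w y]add0r Qw addrAC addrA.
Qed.

Lemma card_additive_translations_dvd (F : finFieldType) (R : {poly F}) :
  (size R <= #|F|)%N -> (#|additive_translations R| %| #|F|)%N.
Proof.
move=> sR; have inV := mem_additive_translations _ sR.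
have gV : group_set (additive_translations R).
  apply/group_setP; split=> [|y z /inV addy /inV addz]; apply/inV => x.
    by rewrite addr0.
  apply: (addIr R.[0]); rewrite -[(y * z)%g]/(y + z) [x + _]addrA.
  by rewrite addz addrAC addy -[RHS]addrA addz addrA.
by rewrite -cardsT; exact: (cardSg (subsetT (Group gV))).
Qed.

(** The common number of translations is a power of [p], because the
    translations form a subgroup of F_q. *)
Lemma has_additive_index_inverse (p n : nat) (F : finFieldType)
    (P Q : {poly F}) :
    prime p -> #|F| = (p ^ n)%N ->
    (size P <= #|F|)%N -> (size Q <= #|F|)%N ->
    cancel (horner P) (horner Q) -> cancel (horner Q) (horner P) ->
  exists s, has_additive_index p n P s /\ has_additive_index p n Q s.
Proof.
move=> p_prime cardF sP sQ PK QK.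
have := card_additive_translations_dvd sP; rewrite cardF.
case/(dvdn_pfactor _ _ p_prime) => e le_en cardV.
have eqV : #|additive_translations Q| = #|additive_translations P|.
  by apply/eqP; rewrite eqn_leq !card_additive_translations_le.
exists (n - e)%N; rewrite /has_additive_index leq_subr subKn //.
by rewrite -!big_enum !size_prod_XsubC -!cardE eqV cardV.
Qed.

Lemma horner_reduced (F : finFieldType) (R : {poly F}) (x : F) :
  (reduced #|F| R).[x] = R.[x].
Proof.
rewrite [in RHS](divp_eq R ('X^#|F| - 'X)) !hornerE.
by rewrite expf_card subrr mulr0 add0r.
Qed.

Lemma size_reduced (F : finFieldType) (R : {poly F}) :
  (size (reduced #|F| R) <= #|F|)%N.
Proof.
have q_gt1 : (1 < #|F|)%N := finNzRing_gt1 F.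
have sD : size ('X^#|F| - 'X : {poly F}) = #|F|.+1.
  by rewrite size_polyDl ?size_polyXn // size_polyN size_polyX.
by rewrite -ltnS -sD ltn_modp -size_poly_eq0 sD.
Qed.

(** * The inverse permutation *)

(** A divisor of [X^q - X] is a product of some of the distinct linear factors
    [X - iota x]; this brings its zeros down to F_q. *)
Lemma zeros_dvd_finField (F : finFieldType) (K : closedFieldType)
    (iota : {rmorphism F -> K}) (L : {poly K}) :
    L \is monic -> L %| 'X^#|F| - 'X ->
  exists V : seq F,
    [/\ uniq V, size L = (size V).+1
      & forall z, (z \in zeros L) = (z \in map iota V)].
Proof.
move=> L_monic L_dvd.
have : L %| \prod_(x <- enum F) ('X - (iota x)%:P).
  have /(congr1 (map_poly iota)) := finField_genPoly F.
  rewrite rmorphB /= map_polyXn map_polyX => genF.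
  by rewrite -(map_prod_XsubC iota) big_enum -genF.
case/dvdp_prod_XsubC => m; rewrite eqp_monic ?monic_prod_XsubC // => /eqP defL.
exists (mask m (enum F)); split=> [||z]; first by rewrite mask_uniq ?enum_uniq.
  by rewrite defL size_prod_XsubC.
rewrite mem_zeros ?monic_neq0 // defL.
by rewrite -(big_map iota xpredT (fun a => 'X - a%:P)) root_prod_XsubC.
Qed.

Theorem theorem5p8
  (p n : nat) (p_prime : prime p) (n_gt0 : (0 < n)%N)
  (* F = F_q with q = p ^ n, and K an algebraic closure of F *)
  (F : finFieldType) (cardF : #|F| = (p ^ n)%N)
  (K : closedFieldType) (iota : {rmorphism F -> K})
  (K_algebraic : integralRange iota)
  (L : {poly K}) (L_monic : L \is monic) (L_lin : p_linearized p L)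
  (L_dvd : L %| 'X^(p ^ n) - 'X)
  (k : nat) (k_le_n : (k <= n)%N) (deg_L : size L = (p ^ (n - k)).+1)
  (zeta : 'I_(p ^ k) -> F)
  (zeta_reps : complete_representatives iota (zeros L) zeta)
  (P f M : {poly F}) (M_lin : p_linearized p (map_poly iota M))
  (P_def : map_poly iota P = (map_poly iota f \Po L) + map_poly iota M)
  (P_perm : permutation_poly P) :
  let U := zeros L in
  let L0 := vanishing_poly (poly_image (map_poly iota M) U) in
  exists M0 f0 P0 : {poly F},
    [/\ unique (fun A : {poly F} =>
          [/\ p_linearized p (map_poly iota A),
              (size A <= p ^ (n - k))%N
            & forall u : K, u \in U ->
                (map_poly iota A).[(map_poly iota M).[u]] = u]) M0,
        unique (fun g : {poly F} =>
          (size g <= p ^ k)%N /\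
          forall i : 'I_(p ^ k),
            (map_poly iota g).[L0.[iota P.[zeta i]]]
              + (map_poly iota M0).[iota P.[zeta i]] = iota (zeta i)) f0,
        map_poly iota P0 = (map_poly iota f0 \Po L0) + map_poly iota M0,
        permutation_poly P0 /\ (forall y : F, P0.[P.[y]] = y)
      & exists s : nat,
          has_additive_index p n (reduced (p ^ n) P) s /\
          has_additive_index p n P0 s].
Proof.
move=> U L0; have charF := card_finPcharP cardF p_prime.
have charK : p \in [pchar K] by rewrite (fmorph_pchar iota).
have addL := p_linearized_additive charK L_lin.
have addM : additive_poly M.
  exact: additive_poly_map (p_linearized_additive charK M_lin).
have [] := zeros_dvd_finField iota L_monic; first by rewrite cardF.
move=> V [V_uniq /eqP sV defU]; rewrite deg_L eqSS eq_sym in sV.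
have iotaV v : (iota v \in U) = (v \in V).
  by rewrite defU mem_map //; apply: fmorph_inj.
have inV v : (v \in V) = (L.[iota v] == 0).
  by rewrite -iotaV mem_zeros ?monic_neq0.
have V0 : 0 \in V by rewrite inV rmorph0 additive_poly0.
have VB : {in V &, forall v w, v - w \in V}.
  move=> v w; rewrite !inV rmorphB additive_polyB // => /eqP-> /eqP->.
  by rewrite subrr.
have PD : {in V, forall v x, P.[x + v] = P.[x] + M.[v]}.
  move=> v; rewrite inV => /eqP Lv x; apply: (fmorph_inj iota).
  rewrite rmorphD /= -!horner_map P_def !hornerE !horner_comp rmorphD addL Lv.
  rewrite addr0 -addrA; congr (_ + _); rewrite -rmorphD !horner_map.
  by rewrite addM rmorphD.
have P_inj : injective (horner P) := bij_inj P_perm.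
have M_inj : {in V &, injective (horner M)}.
  move=> v w Vv Vw eqM; apply: (addrI 0); apply: P_inj.
  by rewrite !PD // eqM.
(* Lambda is L0 with its coefficients brought down to F *)
pose W := [seq M.[v] | v <- V].
have W_uniq : uniq W by rewrite map_inj_in_uniq.
pose Lambda := vanishing_poly W.
have defL0 : L0 = map_poly iota Lambda by apply: vanishing_poly_image_map.
have addLambda : additive_poly Lambda.
  apply: vanishing_poly_additive => //.
    by rewrite -(additive_poly0 addM) map_f.
  move=> _ _ /mapP[v Vv ->] /mapP[w Vw ->].
  by rewrite -additive_polyB // map_f // VB.
(* M0: the interpolant of the inverse of M on M(V); being additive on M(V),
   it is additive everywhere *)
have [M0 [[sM0 M0K] M0_uniq]] := lagrange_interpolation id W_uniq.
have addM0 : additive_poly (map_poly iota M0).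
  apply: (additive_poly_of_seq (V := map iota W)).
  - by rewrite (map_inj_uniq (fmorph_inj iota)).
  - by rewrite !size_map; case: (V) V0.
  - by rewrite size_map_poly !size_map ltnW.
  move=> _ _ /mapP[_ /mapP[v Vv ->] ->] /mapP[_ /mapP[w Vw ->] ->].
  rewrite -rmorphD -addM !horner_map !M0K ?rmorphD //.
  by rewrite -[w]opprK VB // -sub0r VB.
have addM0F := additive_poly_map addM0.
(* f0: the representatives lie in distinct cosets of V, hence their images
   under P in distinct cosets of M(V), which Lambda separates *)
have repr_uniq i j : zeta i - zeta j \in V -> i = j.
  have [l [_ l_uniq]] := zeta_reps (zeta i).
  rewrite -iotaV rmorphB => /l_uniq <-; symmetry; apply: l_uniq.
  by rewrite subrr -(rmorph0 iota) iotaV.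
have pts_inj : injective (fun i => Lambda.[P.[zeta i]]).
  move=> i j eq_ij; apply: repr_uniq.
  have : Lambda.[P.[zeta i] - P.[zeta j]] == 0.
    by rewrite additive_polyB // eq_ij subrr.
  rewrite root_vanishing_poly => /mapP[v Vv /eqP].
  rewrite subr_eq addrC -PD // => /eqP/P_inj ->.
  by rewrite addrC addKr.
have pts_uniq : uniq [seq Lambda.[P.[zeta i]] | i <- enum 'I_(p ^ k)].
  by rewrite map_inj_uniq ?enum_uniq.
have [f0 [[sf0 f0K] f0_uniq]] :=
  lagrange_interpolation (fun i => zeta i - M0.[P.[zeta i]]) pts_uniq.
rewrite size_enum_ord in sf0 f0_uniq.
pose P0 := (f0 \Po Lambda) + M0.
have PK : cancel (horner P) (horner P0).
  move=> y; have [i [yi _]] := zeta_reps y.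
  rewrite -rmorphB iotaV in yi; move: (y - zeta i) yi (subrK (zeta i) y).
  move=> v Vv <-; rewrite addrC.
  rewrite PD // !hornerE horner_comp addLambda addM0F M0K //.
  have /eqP-> : Lambda.[M.[v]] == 0.
    by rewrite root_vanishing_poly map_f.
  by rewrite addr0 f0K ?mem_enum // addrA subrK.
(* P is onto, so its left inverse is also a right inverse *)
have P0K : cancel (horner P0) (horner P).
  by case: P_perm => Q QK1 QK2 x; rewrite -[x]QK2 PK.
exists M0, f0, P0; split.
- split=> [|A [A_lin sA AK]].
    split; first exact: additive_p_linearized.
      by rewrite -(eqP sV).
    by move=> u; rewrite defU => /mapP[v Vv ->]; rewrite !horner_map M0K.
  apply: M0_uniq; rewrite (eqP sV); split=> // v Vv; apply: (fmorph_inj iota).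
  by rewrite /= -!horner_map AK ?iotaV.
- have eqn (g : {poly F}) i : ((map_poly iota g).[L0.[iota P.[zeta i]]]
      + (map_poly iota M0).[iota P.[zeta i]] == iota (zeta i)) =
      (g.[Lambda.[P.[zeta i]]] == zeta i - M0.[P.[zeta i]]).
    rewrite defL0 !horner_map -rmorphD (inj_eq (fmorph_inj iota)).
    by rewrite -subr_eq opprK.
  split=> [|g [sg gK]].
    by split=> // i; apply/eqP; rewrite eqn f0K ?mem_enum.
  by apply: f0_uniq; split=> // i _; apply/eqP; rewrite -eqn gK.
- by rewrite rmorphD /= map_comp_poly defL0.
- by split=> //; exists (horner P).
(* deg P0 <= (p^k - 1) p^(n-k) or deg P0 < p^(n-k): P0 is its own reduced
   representative *)
have sP0 : (size P0 <= #|F|)%N.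
  have pk_gt0 m : (0 < p ^ m)%N by rewrite expn_gt0 prime_gt0.
  rewrite (leq_trans (size_polyD _ _)) // geq_max; apply/andP; split.
    rewrite (leq_trans (size_comp_poly_leq _ _)) // size_prod_XsubC size_map.
    rewrite (eqP sV) cardF -{2}(subnKC k_le_n) expnD.
    by rewrite ltn_pmul2r //; case: (size f0) sf0 => //= _; apply: pk_gt0.
  by rewrite (leq_trans sM0) // (eqP sV) cardF leq_exp2l ?prime_gt1 ?leq_subr.
rewrite -cardF; apply: has_additive_index_inverse => //.
- exact: size_reduced.
- by move=> x; rewrite horner_reduced PK.
- by move=> x; rewrite horner_reduced P0K.
Qed.
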